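(* There exists a monadic second order (MSO) sentence $\varphi$ in the language of graphs with quantifier depth $\mathrm{q}(\varphi)=4$ whose spectrum $\mathcal{S}(\varphi)$ is infinite.
   Context: $G(n,p)$ denotes the Erdős–Rényi random graph on vertex set $V_n=\{1,\dots,n\}$ in which each pair of vertices is joined by an edge independently with probability $p$. First order (FO) formulae of graphs are built from the relations $\sim$ (adjacency) and $=$, logical connectives, vertex variables, quantifiers $\forall,\exists$ over vertices, and parentheses. MSO formulae additionally allow variables $X,Y,\dots$ ranging over subsets of the vertex set (unary predicates), with atomic formulae $X(x)$ (''$x\in X$'') and quantification over such set variables. The quantifier depth $\mathrm{q}(\varphi)$ is the maximum number of nested quantifiers (vertex or set) in $\varphi$. For a sentence $\varphi$, its spectrum is the set $\mathcal{S}(\varphi)$ defined by $(0,\infty)\setminus\mathcal{S}(\varphi)=\{\alpha>0:\ \lim_{n\to\infty}\mathsf{P}(G(n,n^{-\alpha})\models\varphi)\text{ exists and equals }0\text{ or }1\}$. *)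

(* Defs.v *)
From HB Require Import structures.
From mathcomp Require Import all_boot all_order all_algebra.
From mathcomp Require Import all_classical all_reals all_analysis.

Set Implicit Arguments.
Unset Strict Implicit.
Unset Printing Implicit Defensive.

Import Order.TTheory GRing.Theory Num.Theory.
Import numFieldNormedType.Exports.

Local Open Scope classical_set_scope.
Local Open Scope ring_scope.

(* Well-scoped de Bruijn syntax: the free vertex (resp. set) variables of a
   formula of type [mso V W] are the elements of V (resp. W).  Under a
   quantifier, [None] is the newly bound variable and [Some x] the variable x of
   the outer context. *)
Inductive mso (V W : Type) : Type :=
| mAdj of V & V
| mEq of V & V
| mMem of W & V
| mNot of mso V W
| mAnd of mso V W & mso V W
| mOr of mso V W & mso V W
| mImp of mso V W & mso V W
| mIff of mso V W & mso V W
| mExV of mso (option V) W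
| mAllV of mso (option V) W
| mExS of mso V (option W)
| mAllS of mso V (option W).

Arguments mAdj {V W}.
Arguments mEq {V W}.

Definition sentence : Type := mso void void.

Fixpoint qdepth (V W : Type) (f : mso V W) : nat :=
  match f with
  | mAdj _ _ | mEq _ _ | mMem _ _ => 0%N
  | mNot g => qdepth g
  | mAnd g h | mOr g h | mImp g h | mIff g h => maxn (qdepth g) (qdepth h)
  | mExV g | mAllV g => (qdepth g).+1
  | mExS g | mAllS g => (qdepth g).+1
  end.

Definition extend (V A : Type) (v : V -> A) (a : A) (x : option V) : A :=
  if x is Some y then v y else a.

Fixpoint sat (T : finType) (adj : rel T) (V W : Type) (f : mso V W) :
    (V -> T) -> (W -> {set T}) -> bool :=
  match f with
  | mAdj x y => fun v _ => adj (v x) (v y)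
  | mEq x y => fun v _ => v x == v y
  | mMem X x => fun v w => v x \in w X
  | mNot g => fun v w => ~~ sat adj g v w
  | mAnd g h => fun v w => sat adj g v w && sat adj h v w
  | mOr g h => fun v w => sat adj g v w || sat adj h v w
  | mImp g h => fun v w => sat adj g v w ==> sat adj h v w
  | mIff g h => fun v w => sat adj g v w == sat adj h v w
  | mExV g => fun v w => [exists a : T, sat adj g (extend v a) w]
  | mAllV g => fun v w => [forall a : T, sat adj g (extend v a) w]
  | mExS g => fun v w => [exists A : {set T}, sat adj g v (extend w A)]
  | mAllS g => fun v w => [forall A : {set T}, sat adj g v (extend w A)]
  end.

Definition models (T : finType) (adj : rel T) (phi : sentence) : bool :=
  sat adj phi (of_void T) (of_void {set T}).

Definition vpairs (n : nat) : {set {set 'I_n}} :=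
  [set e : {set 'I_n} | #|e| == 2]%SET.

(* A graph on 'I_n is given by its edge set E, a subset of [vpairs n]; it has no
   loops since [set x; x] is a singleton. *)
Definition edge_rel (n : nat) (E : {set {set 'I_n}}) : rel 'I_n :=
  fun x y => [set x; y]%SET \in E.

(* The probability that G(n,p) has edge set exactly E. *)
Definition gnp_weight (R : realType) (n : nat) (p : R)
    (E : {set {set 'I_n}}) : R :=
  \prod_(e in vpairs n) (if e \in E then p else 1 - p).

Definition gnp_prob (R : realType) (n : nat) (p : R) (phi : sentence) : R :=
  \sum_(E in powerset (vpairs n) | models (edge_rel E) phi) gnp_weight p E.

Definition zero_one_at (R : realType) (phi : sentence) (alpha : R) : Prop :=
  let P := fun n : nat => gnp_prob n (n%:R `^ (- alpha)) phi in
  (P @ \oo --> (0 : R)) \/ (P @ \oo --> (1 : R)).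

Definition spectrum (R : realType) (phi : sentence) : set R :=
  [set alpha | 0 < alpha /\ ~ zero_one_at phi alpha].
Arguments spectrum R phi : clear implicits.

(* Main.v *)
Require Import Defs.
From mathcomp Require Import all_boot all_order all_algebra.
From mathcomp Require Import all_classical all_reals all_analysis.
From mathcomp Require Import fintype finset ring lra zify.

Set Implicit Arguments.
Unset Strict Implicit.
Unset Printing Implicit Defensive.

Import Order.TTheory GRing.Theory Num.Theory.

Local Open Scope ring_scope.

(** The sentence asks for a vertex set X inducing a complete multipartite graph
    with at least three parts, such that no vertex outside X is adjacent to all
    of some part of X.  Take alpha = 1/J, that is p^J = 1/n.  With high
    probability every set of fewer than J vertices has a common neighbour
    missing two further prescribed vertices, so all parts have size at least J
    and X contains K_{J,J,J}.  The expected number of copies of K_{J,J,J} is at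
    most 1/(J!)^3, which keeps the probability away from 1.  Conversely the
    number of copies has bounded second moment, and a given copy is induced with
    no outside vertex dominating a part with probability about
    (1 - 1/n)^(3n), which keeps the probability away from 0.  Hence every 1/J
    with J >= 2 is in the spectrum.  It suffices to look at n = m^J, where
    p = 1/m. *)

(** * The sentence *)

Definition mand3 V W (f g h : mso V W) := mAnd f (mAnd g h).

(** Transitivity of non-adjacency makes [X] complete multipartite, a triangle gives three parts, and
    the part of [y] is the set of its non-neighbours in [X]. Each conjunct spends three vertex
    quantifiers below the single set quantifier. *)
Definition phi : sentence :=
  let X : option void := None in
  let x : option (option (option void)) := Some (Some None) in
  let y : option (option (option void)) := Some None in
  let z : option (option (option void)) := None in
  mExS (mand3
    (mAllV (mAllV (mAllV
       (mImp (mAnd (mand3 (mMem X x) (mMem X y) (mMem X z))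
                   (mAnd (mNot (mAdj x y)) (mNot (mAdj y z))))
             (mNot (mAdj x z))))))
    (mExV (mExV (mExV
       (mAnd (mand3 (mMem X x) (mMem X y) (mMem X z))
             (mand3 (mAdj x y) (mAdj y z) (mAdj x z))))))
    (mAllV (mAllV (mExV
       (mImp (mAnd (mNot (mMem X x)) (mMem X y))
             (mand3 (mMem X z) (mNot (mAdj z y)) (mNot (mAdj z x)))))))).

Lemma qdepth_phi : qdepth phi = 4%N.
Proof. by []. Qed.

Section Semantics.
Variables (T : finType) (adj : rel T).

Definition multipartite (X : {set T}) := forall x y z,
  x \in X -> y \in X -> z \in X -> ~~ adj x y -> ~~ adj y z -> ~~ adj x z.

Definition has_triangle (X : {set T}) := exists x y z,
  [/\ x \in X, y \in X & z \in X] /\ [/\ adj x y, adj y z & adj x z].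

Definition undominated (X : {set T}) := forall x y,
  x \notin X -> y \in X -> exists z, [/\ z \in X, ~~ adj z y & ~~ adj z x].

Lemma models_phiP : models adj phi <->
  exists X, [/\ multipartite X, has_triangle X & undominated X].
Proof.
rewrite /models /phi /mand3 /=; split.
- move=> /existsP[X /and3P[/forallP M /existsP[a /existsP[b /existsP[c abc]]] Q]].
  move: abc => /= /andP[/and3P[aX bX cX] /and3P[ab bc ac]].
  exists X; split.
  + move=> x y z xX yX zX nxy nyz.
    move: (M x) => /forallP/(_ y)/forallP/(_ z) /=.
    by rewrite xX yX zX nxy nyz.
  + by exists a, b, c.
  + move=> x y xX yX.
    move: Q => /forallP/(_ x)/forallP/(_ y)/existsP[z] /=.
    rewrite xX yX /= => /and3P[? ? ?].
    by exists z.
- move=> [X [M [a [b [c [[aX bX cX] [ab bc ac]]]]] Q]].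
  apply/existsP; exists X; apply/and3P; split.
  + apply/forallP => x; apply/forallP => y; apply/forallP => z /=.
    apply/implyP => /andP[/and3P[xX yX zX] /andP[nxy nyz]].
    exact: M nxy nyz.
  + apply/existsP; exists a; apply/existsP; exists b; apply/existsP; exists c.
    by rewrite /= aX bX cX ab bc ac.
  + apply/forallP => x; apply/forallP => y; apply/existsP.
    (* The quantifier over [z] stands outside the implication, so when the premise fails any witness
       serves; [x] is at hand. *)
    have [xX|xX] := boolP (x \in X); first by exists x.
    have [yX|yX] := boolP (y \in X); last by exists x.
    have [z [zX zy zx]] := Q _ _ xX yX.
    by exists z; rewrite /= zX zy zx.
Qed.

End Semantics.

(** * Patterns of present and absent edges in G(n,p) *)

Lemma disjointUs (T : finType) (A B C : {set T}) :
  [disjoint A :|: B & C] = [disjoint A & C] && [disjoint B & C].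
Proof. by rewrite !disjoints_subset subUset. Qed.

Lemma disjoint_setU (T : finType) (A B C : {set T}) :
  [disjoint A & B :|: C] = [disjoint A & B] && [disjoint A & C].
Proof. by rewrite !(disjoint_sym A) disjointUs. Qed.

Section Gnp.
Variables (R : realType) (n : nat) (p : R).
Local Notation U := (vpairs n).

Definition gnp_expect (F : {set {set 'I_n}} -> R) : R :=
  \sum_(E in powerset U) gnp_weight p E * F E.

Definition pattern (P N E : {set {set 'I_n}}) : bool :=
  (P \subset E) && (N \subset ~: E).

Lemma gnp_probE f : gnp_prob n p f = gnp_expect (fun E => (models (edge_rel E) f)%:R).
Proof.
rewrite /gnp_prob /gnp_expect [RHS](bigID (fun E => models (edge_rel E) f)) /=.
rewrite [X in _ = _ + X]big1 ?addr0; last first.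
  by move=> E /andP[_ /negbTE ->]; rewrite mulr0.
by apply: eq_bigr => E /andP[_ ->]; rewrite mulr1.
Qed.

Implicit Types (F G : {set {set 'I_n}} -> R) (E : {set {set 'I_n}}).

Lemma gnp_expect_sum (I : finType) (A : pred I) (F : I -> {set {set 'I_n}} -> R) :
  gnp_expect (fun E => \sum_(i | A i) F i E) = \sum_(i | A i) gnp_expect (F i).
Proof.
rewrite /gnp_expect exchange_big /=; apply: eq_bigr => E _.
by rewrite mulr_sumr.
Qed.

Lemma gnp_expectB F G : gnp_expect (fun E => F E - G E) = gnp_expect F - gnp_expect G.
Proof. by rewrite /gnp_expect -sumrB; apply: eq_bigr => E _; rewrite mulrBr. Qed.

Lemma gnp_expectD F G : gnp_expect (fun E => F E + G E) = gnp_expect F + gnp_expect G.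
Proof. by rewrite /gnp_expect -big_split; apply: eq_bigr => E _; rewrite mulrDr. Qed.

Lemma ler_gnp_expect F G : 0 <= p <= 1 ->
  (forall E, E \subset U -> F E <= G E) -> gnp_expect F <= gnp_expect G.
Proof.
move=> /andP[p0 p1] FG; apply: ler_sum => E; rewrite powersetE => EU.
apply: ler_wpM2l (FG _ EU).
by apply: prodr_ge0 => e _; case: ifP => // _; rewrite subr_ge0.
Qed.

Lemma eq_gnp_expect F G : (forall E, F E = G E) -> gnp_expect F = gnp_expect G.
Proof. by move=> FG; apply: eq_bigr => E _; rewrite FG. Qed.

(** Weight times indicator is a product over all [e] of a factor depending only on whether [e] lies
    in [E], so the sum over [E] factorises edge by edge. *)
Lemma gnp_expect_pattern (P N : {set {set 'I_n}}) :
  P \subset U -> N \subset U -> [disjoint P & N] ->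
  gnp_expect (fun E => (pattern P N E)%:R) = p ^+ #|P| * (1 - p) ^+ #|N|.
Proof.
move=> PU NU PN.
(* Factors for [e] present ([f]) and absent ([g]), zero where the pattern forbids that state.
   Outside the vertex pairs [f] is 0 and [g] is 1, which lets [E] range over all sets. *)
pose f e : R := if e \in U then (if e \in N then 0 else p) else 0.
pose g e : R := if e \in U then (if e \in P then 0 else 1 - p) else 1.
have -> : gnp_expect (fun E => (pattern P N E)%:R) =
    \sum_(E : {set {set 'I_n}}) \prod_e (if e \in E then f e else g e).
  rewrite /gnp_expect big_mkcond /=; apply: eq_bigr => E _.
  rewrite powersetE; case: ifP => [EU|/negbT/subsetPn[e eE eU]]; last first.
    by rewrite (bigD1 e) //= eE /f (negbTE eU) mul0r.
  rewrite [RHS](bigID (fun e => e \in U)) /= [X in _ = _ * X]big1 ?mulr1; last first.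
    move=> e eU; rewrite /g (negbTE eU) ifN //.
    by apply: contra eU => /(subsetP EU).
  have [/andP[PE NE]|/nandP[|]] := boolP (pattern P N E).
  - rewrite mulr1; apply: eq_bigr => e eU; rewrite /f /g eU.
    case: ifPn => eE; case: ifPn => //.
      by move=> /(subsetP NE); rewrite inE eE.
    by move=> /(subsetP PE); rewrite (negbTE eE).
  - move=> /subsetPn[e eP eE]; rewrite mulr0 (bigD1 e) /=; last exact: (subsetP PU).
    by rewrite (negbTE eE) /g (subsetP PU) // eP mul0r.
  - move=> /subsetPn[e eN]; rewrite inE negbK => eE.
    rewrite mulr0 (bigD1 e) /=; last exact: (subsetP NU).
    by rewrite eE /f (subsetP NU) // eN mul0r.
rewrite -bigA_distr -!prodr_const [X in X * _]big_mkcond [X in _ * X]big_mkcond.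
rewrite -big_split /=; apply: eq_bigr => e _; rewrite /f /g.
have [eP|eP] := boolP (e \in P); have [eN|eN] := boolP (e \in N).
- by move: PN; rewrite disjoint_subset => /subsetP/(_ _ eP); rewrite inE eN.
- by rewrite (subsetP PU) // addr0 mulr1.
- by rewrite (subsetP NU) // add0r mul1r.
- by case: ifP => _; rewrite ?add0r ?mul1r // addrC subrK.
Qed.

(** Independence of events on disjoint edge sets. Expanding the first factor leaves a difference of
    two expectations of the same shape, the second with that pattern absorbed into [P] and [N];
    hence the induction is run for general [P] and [N]. *)
Lemma gnp_expect_pattern_avoid (I : eqType) (s : seq I)
    (Pf Nf : I -> {set {set 'I_n}}) (P N : {set {set 'I_n}}) :
  uniq s -> P \subset U -> N \subset U -> [disjoint P & N] ->
  {in s, forall i, Pf i \subset U} -> {in s, forall i, Nf i \subset U} ->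
  {in s, forall i, [disjoint Pf i & Nf i]} ->
  {in s, forall i, [disjoint P :|: N & Pf i :|: Nf i]} ->
  {in s &, forall i j, i != j -> [disjoint Pf i :|: Nf i & Pf j :|: Nf j]} ->
  gnp_expect (fun E => (pattern P N E)%:R *
                       \prod_(i <- s) (1 - (pattern (Pf i) (Nf i) E)%:R)) =
  p ^+ #|P| * (1 - p) ^+ #|N| *
  \prod_(i <- s) (1 - p ^+ #|Pf i| * (1 - p) ^+ #|Nf i|).
Proof.
elim: s P N => [|i s IH] P N.
  move=> _ PU NU PN _ _ _ _ _; rewrite big_nil mulr1 -gnp_expect_pattern //.
  by apply: eq_gnp_expect => E; rewrite big_nil mulr1.
move=> /= /andP[is_ us] PU NU PN PfU NfU PNf D1 D2.
have sub j : j \in s -> j \in i :: s by rewrite inE orbC => ->.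
have ii : i \in i :: s by rewrite inE eqxx.
have ine j : j \in s -> i != j by apply: contraTneq => <-.
rewrite big_cons.
transitivity (gnp_expect (fun E => (pattern P N E)%:R *
      \prod_(j <- s) (1 - (pattern (Pf j) (Nf j) E)%:R) -
    (pattern (P :|: Pf i) (N :|: Nf i) E)%:R *
      \prod_(j <- s) (1 - (pattern (Pf j) (Nf j) E)%:R))).
  apply: eq_gnp_expect => E; rewrite big_cons mulrA -mulrBl; congr (_ * _).
  rewrite mulrBr mulr1 -natrM mulnb; congr (_ - (_ : bool)%:R).
  by rewrite /pattern !subUset andbACA.
have /and4P[dPPi dPNi dNPi dNNi] : [&& [disjoint P & Pf i], [disjoint P & Nf i],
    [disjoint N & Pf i] & [disjoint N & Nf i]].
  by have := D1 _ ii; rewrite disjointUs !disjoint_setU -andbA.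
rewrite gnp_expectB !IH //.
- rewrite !cardsU !(disjoint_setI0 _) // !cards0 !subn0 !exprD.
  by rewrite [X in _ - X * _]mulrACA -mulrBl [RHS]mulrA mulrBr mulr1.
- by rewrite subUset PU PfU.
- by rewrite subUset NU NfU.
- by rewrite disjointUs !disjoint_setU PN dPNi PNf // disjoint_sym dNPi.
- by move=> j js; exact: PfU (sub _ js).
- by move=> j js; exact: NfU (sub _ js).
- by move=> j js; exact: PNf (sub _ js).
- move=> j js; rewrite setUACA disjointUs D1 ?sub //=.
  by apply: D2 (ine _ js) => //; apply: sub.
- by move=> j k js ks; exact: D2 (sub _ js) (sub _ ks).
- by move=> j js; exact: PfU (sub _ js).
- by move=> j js; exact: NfU (sub _ js).
- by move=> j js; exact: PNf (sub _ js).
- by move=> j js; exact: D1 (sub _ js).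
- by move=> j k js ks; exact: D2 (sub _ js) (sub _ ks).
Qed.

End Gnp.

(** * Complete tripartite graphs *)

Lemma set2_inj (T : finType) (a b c d : T) : [set a; b] = [set c; d] ->
  (a = c /\ b = d) \/ (a = d /\ b = c).
Proof.
move=> /setP e; move: (e a) (e b) (e c) (e d); rewrite !inE !eqxx ?orbT /=.
move=> /esym/orP[]/eqP-> /esym/orP[]/eqP->; rewrite ?orbb ?eqxx ?orbT.
- by move=> _ /eqP->; left.
- by left.
- by right.
- by move=> /eqP-> _; right.
Qed.

Lemma set2_vpairs n (a b : 'I_n) : a != b -> [set a; b] \in vpairs n.
Proof. by move=> ab; rewrite inE cards2 ab. Qed.

Lemma edge_rel_sym n (E : {set {set 'I_n}}) (x y : 'I_n) :
  edge_rel E x y = edge_rel E y x.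
Proof. by rewrite /edge_rel setUC. Qed.

Lemma edge_rel_irr n (E : {set {set 'I_n}}) (x : 'I_n) :
  E \subset vpairs n -> edge_rel E x x = false.
Proof.
move=> /subsetP EU; apply/negbTE/negP => /EU.
by rewrite inE cards2 eqxx.
Qed.

Section Tripartite.
Variable J : nat.
Local Notation idx := ('I_3 * 'I_J)%type.
Implicit Type G : {set idx}.

(** Orienting each pair by its part index lists every edge of K_{J,J,J} exactly once. *)
Definition cross : {set idx * idx} := [set d : idx * idx | (d.1.1 < d.2.1)%N].

Definition cross_in (G : {set idx}) : {set idx * idx} :=
  [set d in cross | (d.1 \in G) && (d.2 \in G)].

Definition part_size (G : {set idx}) (r : 'I_3) : nat := (\sum_j ((r, j) \in G))%N.

Lemma part_size_le G r : (part_size G r <= J)%N.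
Proof.
rewrite -[X in (_ <= X)%N]card_ord -sum1_card; apply: leq_sum => j _.
exact: leq_b1.
Qed.

Lemma sum_idx (F : idx -> nat) :
  (\sum_i F i = \sum_(r : 'I_3) \sum_(j : 'I_J) F (r, j))%N.
Proof. by rewrite pair_bigA; apply: eq_bigr => -[]. Qed.

Lemma card_part_size G : #|G| = (\sum_r part_size G r)%N.
Proof.
rewrite -sum1_card big_mkcond /= [RHS]pair_big /=.
by apply: eq_bigr => -[r j] _ /=; case: (_ \in _).
Qed.

Lemma card_cross_in G : let a := part_size G in
  #|cross_in G| = (a ord0 * a (lift ord0 ord0) + a ord0 * a (lift ord0 (lift ord0 ord0))
                   + a (lift ord0 ord0) * a (lift ord0 (lift ord0 ord0)))%N.
Proof.
have -> : #|cross_in G| =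
    (\sum_(r : 'I_3) \sum_(s : 'I_3) (r < s)%N * (part_size G r * part_size G s))%N.
  rewrite -sum1_card big_mkcond /=.
  transitivity (\sum_(i : idx) \sum_(k : idx)
      (((i.1 < k.1)%N : nat) * ((i \in G) * (k \in G))))%N.
    rewrite pair_big /=; apply: eq_bigr => -[i k] _ /=; rewrite !inE /=.
    by case: (_ < _)%N; case: (i \in G); case: (k \in G).
  rewrite sum_idx; apply: eq_bigr => r _.
  rewrite (eq_bigr _ (fun j _ => sum_idx _)) /=.
  rewrite exchange_big /=; apply: eq_bigr => s _.
  under eq_bigr do rewrite -big_distrr /=.
  rewrite -big_distrr /=; congr (_ * _)%N; rewrite /part_size big_distrl /=.
  by apply: eq_bigr => j _; rewrite big_distrr.
by rewrite !big_ord_recl !big_ord0 /= !(add0n, addn0, mul0n, mul1n).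
Qed.

Lemma card_idx_sum G : let a := part_size G in
  #|G| = (a ord0 + a (lift ord0 ord0) + a (lift ord0 (lift ord0 ord0)))%N.
Proof.
by rewrite /= card_part_size !big_ord_recl big_ord0 addn0 addnA.
Qed.

Lemma card_idx : #|{: idx}| = (3 * J)%N.
Proof. by rewrite card_prod !card_ord. Qed.

Lemma card_cross : #|cross| = (3 * J ^ 2)%N.
Proof.
have -> : cross = cross_in setT by apply/setP => d; rewrite !inE !andbT.
rewrite card_cross_in.
have e r : part_size setT r = J.
  rewrite /part_size; under eq_bigr do rewrite inE.
  by rewrite sum_nat_const card_ord muln1.
rewrite !e; lia.
Qed.

Lemma card_cross_in_le G : (#|cross_in G| <= 3 * J ^ 2)%N.
Proof. by rewrite -card_cross subset_leq_card //; apply/subsetP => d; rewrite !inE => /andP[]. Qed.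

(* Equality in e(G) <= J |G| forces every vertex of G to see both other parts
   entirely inside G. *)
Lemma card_cross_in_lt G : G != set0 -> G != setT -> (#|cross_in G| < J * #|G|)%N.
Proof.
move=> G0 GT.
have g0 : (0 < #|G|)%N by rewrite card_gt0.
have gT : (#|G| < 3 * J)%N by rewrite -card_idx -cardsT proper_card // properT.
move: g0 gT; rewrite card_cross_in card_idx_sum.
have := part_size_le G ord0; have := part_size_le G (lift ord0 ord0).
have := part_size_le G (lift ord0 (lift ord0 ord0)).
move: (part_size _ _) (part_size _ _) (part_size _ _) => c b a.
nia.
Qed.

Section Edges.
Variables (n : nat) (v : idx -> 'I_n).
Hypothesis v_inj : injective v.

Definition complete_edges : {set {set 'I_n}} :=
  [set [set v d.1; v d.2] | d in cross].

Definition inner_edges : {set {set 'I_n}} :=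
  [set [set v d.1; v d.2] | d in [set d : idx * idx | (d.1.1 == d.2.1) && (d.1 != d.2)]].

(** The index pairs a vertex with a part; all these edges are present exactly when the vertex
    dominates that part. *)
Definition star_edges (xr : 'I_n * 'I_3) : {set {set 'I_n}} :=
  [set [set xr.1; v (xr.2, j)] | j : 'I_J].

Lemma card_complete_edges : #|complete_edges| = (3 * J ^ 2)%N.
Proof.
rewrite card_in_imset ?card_cross // => -[d1 d2] [e1 e2]; rewrite !inE /= => d e.
move=> /set2_inj[[/v_inj-> /v_inj->]//|[/v_inj d1e /v_inj d2e]].
by move: d e; rewrite d1e d2e => d e; have := ltn_trans d e; rewrite ltnn.
Qed.

Lemma complete_edges_sub : complete_edges \subset vpairs n.
Proof.
apply/subsetP => _ /imsetP[d dc ->]; apply: set2_vpairs.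
move: dc; rewrite inE (inj_eq v_inj); apply: contraTneq => ->.
by rewrite ltnn.
Qed.

Lemma inner_edges_sub : inner_edges \subset vpairs n.
Proof.
apply/subsetP => _ /imsetP[d dc ->]; apply: set2_vpairs.
by move: dc; rewrite inE (inj_eq v_inj) => /andP[].
Qed.

Lemma card_inner_edges : (#|inner_edges| <= 9 * J ^ 2)%N.
Proof.
apply: leq_trans (leq_imset_card _ _) _; apply: leq_trans (max_card _) _.
by rewrite card_prod card_idx; lia.
Qed.

Lemma complete_inner_disjoint : [disjoint complete_edges & inner_edges].
Proof.
rewrite disjoints_subset; apply/subsetP => _ /imsetP[d dc ->].
rewrite inE; apply/imsetP => -[e ec] /set2_inj[[/v_inj e1 /v_inj e2]|[/v_inj e1 /v_inj e2]].
all: by move: ec dc; rewrite !inE e1 e2 => /andP[/eqP -> _]; rewrite ltnn.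
Qed.

Lemma star_edges_sub xr : xr.1 \notin codom v -> star_edges xr \subset vpairs n.
Proof.
move=> xv; apply/subsetP => _ /imsetP[j _ ->]; apply: set2_vpairs.
by apply: contraNneq xv => ->; apply: codom_f.
Qed.

Lemma card_star_edges xr : xr.1 \notin codom v -> #|star_edges xr| = J.
Proof.
move=> xv; rewrite card_imset ?card_ord // => j k /set2_inj[[_ /v_inj[]]//|[x1 _]].
by move: xv; rewrite x1 codom_f.
Qed.

(** This makes the domination events independent over all pairs of an outside vertex and a part. *)
Lemma star_edges_disjoint xr ys : xr.1 \notin codom v -> ys.1 \notin codom v ->
  xr != ys -> [disjoint star_edges xr & star_edges ys].
Proof.
case: xr ys => x r [y s] /= xv yv ne; rewrite disjoints_subset.
apply/subsetP => _ /imsetP[j _ ->]; rewrite inE; apply/imsetP => -[k _] /=.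
move=> /set2_inj[[xy /v_inj[rs _]]|[xk _]].
  by move: ne; rewrite xy rs eqxx.
by move: xv; rewrite xk codom_f.
Qed.

Lemma star_edges_disjoint_inside xr : xr.1 \notin codom v ->
  [disjoint complete_edges :|: inner_edges & star_edges xr].
Proof.
move=> xv; rewrite disjointUs !disjoints_subset.
apply/andP; split; apply/subsetP => _ /imsetP[d _ ->]; rewrite inE.
all: apply/imsetP => -[j _] /set2_inj[[x1 _]|[_ x2]].
all: by move: xv; rewrite -?x1 -?x2 codom_f.
Qed.

End Edges.
End Tripartite.

(** * Lower bound *)

Section Blocks.
(* The vertices are split into one block of size b per vertex of K_{J,J,J}; only
   copies taking one vertex from each block are counted. *)
Variables (J b n : nat) (g : ('I_3 * 'I_J) * 'I_b -> 'I_n).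
Hypothesis g_inj : injective g.
Local Notation idx := ('I_3 * 'I_J)%type.
Implicit Types t u : {ffun idx -> 'I_b}.

Definition place t (i : idx) : 'I_n := g (i, t i).

Lemma place_inj t : injective (place t).
Proof. by move=> i j /g_inj[]. Qed.

Definition agree t u : {set idx} := [set i | t i == u i].

(** The blocks are disjoint, so a vertex determines its index: a common edge joins two vertices at
    which [t] and [u] agree. *)
Lemma card_complete_meet t u :
  (#|complete_edges (place t) :&: complete_edges (place u)| <=
   #|cross_in (agree t u)|)%N.
Proof.
apply: (@leq_trans #|[set [set place t d.1; place t d.2] | d in cross_in (agree t u)]|).
  apply/subset_leq_card/subsetP => e /setIP[/imsetP[d dc ->] /imsetP[d' dc']].
  move=> /set2_inj[[/g_inj[a1 a2] /g_inj[b1 b2]]|[/g_inj[a1 _] /g_inj[b1 _]]].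
    by apply: imset_f; rewrite !inE a2 b2 -!a1 -!b1 !eqxx !andbT; move: dc; rewrite inE.
  by move: dc dc'; rewrite !inE a1 b1 => l1 l2; have := ltn_trans l1 l2; rewrite ltnn.
exact: leq_imset_card.
Qed.

Variables (R : realType) (p : R).

Definition outside t : {set 'I_n * 'I_3} :=
  [set xr | xr.1 \notin codom (place t)].

(** The indicator that the copy is induced and that no outside vertex dominates a part, written as a
    product so that [gnp_expect_pattern_avoid] computes its expectation. *)
Definition isolated_copy t (E : {set {set 'I_n}}) : R :=
  (pattern (complete_edges (place t)) (inner_edges (place t)) E)%:R *
  \prod_(xr <- enum (outside t)) (1 - (pattern (star_edges (place t) xr) set0 E)%:R).

Lemma card_outside t : #|outside t| = (3 * (n - 3 * J))%N.
Proof.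
have -> : outside t = setX (~: [set x in codom (place t)]) setT.
  by apply/setP => -[x r]; rewrite !inE andbT.
rewrite cardsX cardsT card_ord mulnC cardsCs setCK card_ord cardsE.
by rewrite (card_codom (@place_inj t)) card_idx.
Qed.

Lemma isolated_copy_ge0 t E : 0 <= isolated_copy t E.
Proof.
apply: mulr_ge0 => //; apply: prodr_ge0 => i _.
by rewrite subr_ge0 lern1 leq_b1.
Qed.

Lemma isolated_copy_le t E :
  isolated_copy t E <= (complete_edges (place t) \subset E)%:R.
Proof.
apply: (@le_trans _ _ ((pattern (complete_edges (place t)) (inner_edges (place t)) E)%:R * 1)).
  apply: ler_wpM2l => //; apply: prodr_ile1 => i _.
  by rewrite subr_ge0 lern1 leq_b1 /= gerBl.
by rewrite mulr1 ler_nat /pattern; case: (_ \subset _) => //; exact: leq_b1.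
Qed.

Lemma isolated_copy_models t (E : {set {set 'I_n}}) : (0 < J)%N -> E \subset vpairs n ->
  isolated_copy t E != 0 -> models (edge_rel E) phi.
Proof.
move=> J0 EU; rewrite mulf_eq0 negb_or => /andP[]; rewrite pnatr_eq0 eqb0 negbK.
move=> /andP[/subsetP KE /subsetP NE]; rewrite big_enum => /prodf_neq0 out.
have irr x : edge_rel E x x = false by apply: edge_rel_irr.
have adjP i j : edge_rel E (place t i) (place t j) = (i.1 != j.1).
  have [ij|] := altP (i.1 =P j.1).
    have [->|ne] := eqVneq i j; first exact: irr.
    apply/negbTE; have := NE [set place t i; place t j]; rewrite inE; apply.
    by apply/imsetP; exists (i, j) => //; rewrite inE /= ij eqxx.
  rewrite -val_eqE neq_ltn => /orP[] lt; last rewrite edge_rel_sym.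
  - by apply: KE; apply/imsetP; exists (i, j) => //; rewrite inE.
  - by apply: KE; apply/imsetP; exists (j, i) => //; rewrite inE.
apply/models_phiP; exists [set place t i | i : idx]; split.
- move=> _ _ _ /imsetP[i _ ->] /imsetP[j _ ->] /imsetP[k _ ->].
  by rewrite !adjP !negbK => /eqP-> /eqP->.
- pose o := Ordinal J0.
  exists (place t (ord0, o)), (place t (lift ord0 ord0, o)),
         (place t (lift ord0 (lift ord0 ord0), o)).
  by rewrite !adjP !imset_f.
- move=> x _ xX /imsetP[i _ ->].
  have xo : (x, i.1) \in outside t.
    by rewrite inE /=; apply: contra xX => /codomP[j ->]; rewrite imset_f.
  (* The star from [x] to the part of [i] misses an edge; its end in that part is the required
     witness. *)
  have := out _ xo; rewrite subr_eq0 eq_sym pnatr_eq1 eqb1 /pattern sub0set andbT.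
  move=> /subsetPn[e /imsetP[j _ ->] /= xj].
  exists (place t (i.1, j)); rewrite imset_f // adjP /= eqxx.
  by split=> //; rewrite edge_rel_sym.
Qed.

Lemma expect_isolated_copy t :
  gnp_expect p (isolated_copy t) =
  p ^+ (3 * J ^ 2) * (1 - p) ^+ #|inner_edges (place t)| *
  (1 - p ^+ J) ^+ (3 * (n - 3 * J)).
Proof.
have ti := @place_inj t.
have out xr : xr \in enum (outside t) -> xr.1 \notin codom (place t).
  by rewrite mem_enum inE.
rewrite /isolated_copy gnp_expect_pattern_avoid //.
- rewrite card_complete_edges //; congr (_ * _).
  rewrite -(card_outside t) -[RHS]prodr_const big_enum /=.
  by apply: eq_bigr => xr; rewrite inE => xo; rewrite card_star_edges // cards0 mulr1.
- exact: enum_uniq.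
- exact: complete_edges_sub.
- exact: inner_edges_sub.
- exact: complete_inner_disjoint.
- by move=> xr /out; apply: star_edges_sub.
- by move=> xr _; apply: sub0set.
- by move=> xr _; rewrite disjoint_sym disjoints_subset sub0set.
- by move=> xr /out xo; rewrite setU0 star_edges_disjoint_inside.
- by move=> xr ys /out xo /out yo ne; rewrite !setU0 star_edges_disjoint.
Qed.

(** If a single copy is present, the left side is at most 1. If there are two or more, every nonzero
    isolated copy sees another one, so its bracket is at most 0. Only pairs of copies enter, which
    suits a second moment estimate. *)
Lemma isolated_copy_bonferroni (E : {set {set 'I_n}}) : (0 < J)%N -> E \subset vpairs n ->
  \sum_t isolated_copy t E *
     (1 - \sum_(u | u != t) (complete_edges (place u) \subset E)%:R)
  <= (models (edge_rel E) phi)%:R.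
Proof.
move=> J0 EU.
have [[t t0]|no] := pselect (exists t, isolated_copy t E != 0); last first.
  rewrite big1 // => t _; have [->|ne] := eqVneq (isolated_copy t E) 0.
    by rewrite mul0r.
  by case: no; exists t.
rewrite (isolated_copy_models J0 EU t0).
have copy u : isolated_copy u E != 0 -> complete_edges (place u) \subset E.
  apply: contraNT => /negbTE nK; have := isolated_copy_le u E.
  by rewrite nK => le0; rewrite eq_le le0 isolated_copy_ge0.
have [[u ut Ku]|uniq_t] := pselect (exists2 u, u != t & complete_edges (place u) \subset E).
  apply: le_trans ler01; apply: sumr_le0 => w _.
  have [->|w0] := eqVneq (isolated_copy w E) 0; first by rewrite mul0r.
  apply: mulr_ge0_le0; first exact: isolated_copy_ge0.
  (* A copy other than [w] is always available among [t] and [u]. *)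
  have [x xw Kx] : exists2 x, x != w & complete_edges (place x) \subset E.
    have [wt|wt] := eqVneq w t; first by exists u => //; rewrite wt.
    by exists t; [rewrite eq_sym|exact: copy].
  rewrite subr_le0 (bigD1 x) //= Kx lerDl.
  by apply: sumr_ge0.
rewrite (bigD1 t) //= [X in _ + X]big1 ?addr0.
  rewrite [X in 1 - X]big1 ?subr0 ?mulr1; last first.
    move=> u ut; case: (boolP (_ \subset _)) => // Ku.
    by case: uniq_t; exists u.
  by apply: le_trans (isolated_copy_le t E) _; rewrite lern1 leq_b1.
move=> u ut; have [->|u0] := eqVneq (isolated_copy u E) 0; first by rewrite mul0r.
by case: uniq_t; exists u => //; exact: copy.
Qed.

Hypotheses (p_gt0 : 0 < p) (p_le1 : p <= 1) (npJ : n%:R * p ^+ J = 1).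

(* The product is at least n^a, where a is the number of shared vertices, and two
   distinct copies sharing a > 0 vertices share fewer than J a edges. *)
Lemma complete_pair_prob t u : u != t ->
  gnp_expect p (fun E => ((complete_edges (place t) \subset E) &&
                          (complete_edges (place u) \subset E))%:R)
  <= p ^+ (6 * J ^ 2) * (1 + p * \prod_i (1 + (t i == u i)%:R * n%:R)).
Proof.
move=> ut; set K := complete_edges _; set L := complete_edges _.
have -> : gnp_expect p (fun E => ((K \subset E) && (L \subset E))%:R) = p ^+ #|K :|: L|.
  rewrite -[RHS]mulr1 -[X in _ * X](expr0 (1 - p)) -(@cards0 {set 'I_n}) -gnp_expect_pattern.
  - by apply: eq_gnp_expect => E; rewrite /pattern sub0set andbT subUset.
  - by rewrite subUset !complete_edges_sub //; apply: place_inj.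
  - exact: sub0set.
  - by rewrite disjoint_sym disjoints_subset sub0set.
set e := #|cross_in (agree t u)|.
have eK : (6 * J ^ 2 - e <= #|K :|: L|)%N.
  rewrite cardsU !card_complete_edges; [|exact: place_inj..].
  have := card_complete_meet t u; rewrite -/K -/L -/e; lia.
have e3 : (e <= 3 * J ^ 2)%N by apply: card_cross_in_le.
apply: (@le_trans _ _ (p ^+ (6 * J ^ 2 - e))).
  by apply: ler_wiXn2l => //; apply: ltW.
have -> : p ^+ (6 * J ^ 2 - e) = p ^+ (6 * J ^ 2) * p^-1 ^+ e.
  rewrite -[X in _ = p ^+ X * _](@subnK e) ?exprD; last lia.
  by rewrite -mulrA -exprMn divff ?expr1n ?mulr1 // gt_eqF.
apply: ler_wpM2l; first by apply: exprn_ge0; apply: ltW.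
have n_ge0 : 0 <= n%:R :> R by [].
have prod_ge0 : 0 <= \prod_i (1 + (t i == u i)%:R * n%:R) :> R.
  by apply: prodr_ge0 => i _; rewrite addr_ge0 // mulr_ge0.
have [a0|aN0] := eqVneq (agree t u) set0.
  have -> : e = 0%N.
    apply/eqP; rewrite cards_eq0; apply/eqP/setP => d; rewrite !inE.
    by have := a0 => /setP/(_ d.1); rewrite !inE => ->; rewrite andbF.
  by rewrite expr0 lerDl mulr_ge0 // ltW.
have aNT : agree t u != setT.
  apply: contra ut => /eqP aT; apply/eqP/ffunP => i.
  by have := aT => /setP/(_ i); rewrite !inE => /eqP.
have elt := card_cross_in_lt aN0 aNT; rewrite -/e in elt.
apply: (@le_trans _ _ (p * \prod_i (1 + (t i == u i)%:R * n%:R))); last by rewrite lerDr.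
(* The strict inequality [e < J * #|agree t u|] leaves one spare factor [p], which makes the
   overlapping pairs negligible. *)
have -> : p^-1 ^+ e = p * p^-1 ^+ e.+1 by rewrite exprS mulrA divff ?mul1r // gt_eqF.
apply: ler_wpM2l; first exact: ltW.
apply: (@le_trans _ _ (p^-1 ^+ (J * #|agree t u|))).
  by apply: ler_weXn2l => //; rewrite invf_ge1.
have -> : p^-1 ^+ (J * #|agree t u|) = \prod_(i in agree t u) n%:R.
  rewrite prodr_const exprM; congr (_ ^+ _).
  have pJ0 : p ^+ J != 0 by rewrite expf_neq0 // gt_eqF.
  by apply: (mulIf pJ0); rewrite npJ -exprMn mulVf ?expr1n // gt_eqF.
rewrite big_mkcond; apply: ler_prod => i _; rewrite inE; case: eqP => _ /=.
  by rewrite n_ge0 mul1r lerDr ler01.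
by rewrite mul0r addr0 ler01 lexx.
Qed.

(** The sum factorises over coordinates: each of the [b] values contributes 1, and the value [t i]
    contributes a further [n]. *)
Lemma sum_ffun_agree t :
  \sum_(u : {ffun idx -> 'I_b}) \prod_i (1 + (t i == u i)%:R * n%:R) =
  (b%:R + n%:R) ^+ (3 * J) :> R.
Proof.
rewrite -(bigA_distr_bigA (fun i y => 1 + (t i == y)%:R * n%:R)) /=.
rewrite -card_idx -prodr_const; apply: eq_bigr => i _.
rewrite big_split /= sumr_const card_ord; congr (_ + _).
rewrite (bigD1 (t i)) //= eqxx mul1r big1 ?addr0 // => y /negbTE.
by rewrite eq_sym => ->; rewrite mul0r.
Qed.

(** Expectation of [isolated_copy_bonferroni]: the first moment of isolated copies minus the
    expected number of ordered pairs of distinct copies, each bounded uniformly in [t]. *)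
Lemma gnp_prob_phi_ge : (0 < J)%N ->
  b%:R ^+ (3 * J) * (p ^+ (3 * J ^ 2) * (1 - p) ^+ (9 * J ^ 2) * (1 - p ^+ J) ^+ (3 * n)) -
  b%:R ^+ (3 * J) * (p ^+ (6 * J ^ 2) *
     (b%:R ^+ (3 * J) + p * (b%:R + n%:R) ^+ (3 * J)))
  <= gnp_prob n p phi.
Proof.
move=> J0.
have p01 : 0 <= p <= 1 by rewrite p_le1 ltW.
have cardt : #|{: {ffun idx -> 'I_b}}| = (b ^ (3 * J))%N.
  by rewrite card_ffun card_ord card_idx.
rewrite gnp_probE.
apply: (@le_trans _ _ (gnp_expect p (fun E => \sum_t isolated_copy t E *
     (1 - \sum_(u | u != t) (complete_edges (place u) \subset E)%:R)))); last first.
  by apply: (ler_gnp_expect p01) => E EU; apply: isolated_copy_bonferroni.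
apply: (@le_trans _ _ (gnp_expect p (fun E => \sum_t isolated_copy t E -
     \sum_t \sum_(u | u != t) ((complete_edges (place t) \subset E) &&
                          (complete_edges (place u) \subset E))%:R))); last first.
  apply: (ler_gnp_expect p01) => E EU; rewrite -sumrB; apply: ler_sum => t _.
  rewrite mulrBr mulr1 lerD2l lerN2 mulr_sumr; apply: ler_sum => u _.
  by rewrite -mulnb natrM ler_wpM2r // isolated_copy_le.
rewrite gnp_expectB !gnp_expect_sum; apply: lerB.
- rewrite -natrX -cardt [X in X <= _]mulr_natl -sumr_const.
  apply: ler_sum => t _; rewrite expect_isolated_copy.
  have q0 : 0 <= 1 - p by rewrite subr_ge0.
  have q1 : 1 - p <= 1 by rewrite gerBl ltW.
  have pJ : 0 <= p ^+ J <= 1 by rewrite exprn_ge0 ?exprn_ile1 // ltW.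
  apply: ler_pM.
  + by rewrite mulr_ge0 ?exprn_ge0 // ltW.
  + by rewrite exprn_ge0 // subr_ge0; case/andP: pJ.
  + apply: ler_wpM2l; first by rewrite exprn_ge0 // ltW.
    by apply: ler_wiXn2l => //; exact: card_inner_edges.
  + apply: ler_wiXn2l; [by rewrite subr_ge0; case/andP: pJ|by rewrite gerBl; case/andP: pJ|lia].
- rewrite -natrX -cardt [X in _ <= X]mulr_natl -sumr_const.
  apply: ler_sum => t _; rewrite gnp_expect_sum.
  (* Adding the nonnegative term [u = t] completes the sum, so that [sum_ffun_agree] applies. *)
  apply: (@le_trans _ _ (\sum_(u : {ffun idx -> 'I_b}) p ^+ (6 * J ^ 2) *
      (1 + p * \prod_i (1 + (t i == u i)%:R * n%:R)))).
    rewrite [X in _ <= X](bigID (fun u => u != t)) /= -[X in X <= _]addr0; apply: lerD.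
      by apply: ler_sum => u ut; apply: complete_pair_prob.
    apply: sumr_ge0 => u _; apply: mulr_ge0; first by rewrite exprn_ge0 // ltW.
    apply: addr_ge0 => //; apply: mulr_ge0; first exact: ltW.
    apply: prodr_ge0 => i _.
    by rewrite addr_ge0 // mulr_ge0.
  by rewrite -mulr_sumr big_split /= sumr_const -mulr_sumr sum_ffun_agree cardt natrX.
Qed.

End Blocks.

(** * Upper bound *)

Section LargeParts.
Variables (T : finType) (adj : rel T) (k : nat) (X : {set T}).
Hypotheses (adj_sym : symmetric adj) (adj_irr : irreflexive adj).
Hypotheses (X_multi : multipartite adj X) (X_undom : undominated adj X).
Hypothesis extension : forall (h : {ffun 'I_k -> T}) b c,
  b \notin codom h -> c \notin codom h ->
  exists x, [/\ forall i, adj x (h i), ~~ adj x b & ~~ adj x c].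

Definition part_of (a : T) : {set T} := [set z in X | ~~ adj z a].

(* An extension vertex of a small part, avoiding the two other vertices of a
   triangle, cannot lie in X and dominates the part. *)
Lemma part_of_large a b c : a \in X -> b \in X -> c \in X ->
  adj a b -> adj b c -> adj a c -> (k < #|part_of a|)%N.
Proof.
move=> aX bX cX ab bc ac; rewrite ltnNge; apply/negP => small.
have aP : a \in part_of a by rewrite inE aX adj_irr.
(* [h] lists the part; if it has fewer than [k] vertices, the default [a] pads the list without
   leaving the part. *)
pose h := [ffun i : 'I_k => nth a (enum (part_of a)) i].
have hP i : h i \in part_of a.
  rewrite ffunE; have [lt|ge] := ltnP i (size (enum (part_of a))).
    by rewrite -mem_enum mem_nth.
  by rewrite nth_default.
have Ph z : z \in part_of a -> exists i, z = h i.
  rewrite -mem_enum => zP; have lt : (index z (enum (part_of a)) < k)%N.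
    by apply: leq_trans small; rewrite cardE index_mem.
  by exists (Ordinal lt); rewrite ffunE /= nth_index.
have notin d : adj a d -> d \notin codom h.
  move=> ad; apply/negP => /codomP[i di]; have := hP i.
  by rewrite -di inE adj_sym ad andbF.
have [x [xh xb xc]] := extension (notin _ ab) (notin _ ac).
(* Inside [X], a vertex missing both [b] and [c] would make [b] and [c] non-adjacent. *)
have xX : x \notin X.
  apply/negP => xX; have := X_multi bX xX cX; rewrite adj_sym => /(_ xb xc).
  by rewrite bc.
have [z [zX za zx]] := X_undom xX aX.
have [i zi] : exists i, z = h i by apply: Ph; rewrite inE zX.
by move: zx; rewrite zi adj_sym xh.
Qed.

(** Otherwise [a], [u], [v], [b] would form a chain of non-adjacencies, and transitivity would make
    [a] and [b] non-adjacent. *)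
Lemma part_of_adj a b u v : a \in X -> b \in X -> adj a b ->
  u \in part_of a -> v \in part_of b -> adj u v.
Proof.
move=> aX bX ab; rewrite !inE => /andP[uX ua] /andP[vX vb]; apply/negPn/negP => uv.
rewrite adj_sym in ua.
by have := X_multi aX vX bX (X_multi aX uX vX ua uv) vb; rewrite ab.
Qed.

End LargeParts.

Lemma subset_of_card (T : finType) (A : {set T}) (J : nat) : (J <= #|A|)%N ->
  exists2 B : {set T}, B \subset A & #|B| = J.
Proof.
move=> JA; exists [set x in take J (enum A)].
  by apply/subsetP => x; rewrite inE => /mem_take; rewrite mem_enum.
by rewrite cardsE (card_uniqP _) ?take_uniq ?enum_uniq // size_takel // -cardE.
Qed.

Lemma prod_1Bnat (R : comPzRingType) (I : Type) (f : I -> bool) (s : seq I) :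
  \prod_(i <- s) (1 - (f i)%:R) = (all (fun i => ~~ f i) s)%:R :> R.
Proof.
elim: s => [|i s IH]; first by rewrite big_nil.
rewrite big_cons IH /=; case: (f i); first by rewrite subrr mul0r.
by rewrite subr0 mul1r.
Qed.

(** * Failed extensions and the union bound *)

Section Upper.
Variables (n k : nat).
Local Notation J := k.+1.
Local Notation idx := ('I_3 * 'I_J)%type.

Section Extension.
Variables (h : {ffun 'I_k -> 'I_n}) (b c : 'I_n).

Definition ext_present (x : 'I_n) : {set {set 'I_n}} := [set [set x; h i] | i : 'I_k].
Definition ext_absent (x : 'I_n) : {set {set 'I_n}} := [set [set x; b]; [set x; c]].
Definition ext_roots : {set 'I_n} := [set h i | i : 'I_k] :|: [set b; c].

(** Candidates are taken outside the roots so that different candidates use disjoint sets of pairs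
    and are independent. *)
Definition no_extension (E : {set {set 'I_n}}) : bool :=
  all (fun x => ~~ pattern (ext_present x) (ext_absent x) E) (enum (~: ext_roots)).

Lemma no_extensionPn E : ~~ no_extension E -> exists x,
  [/\ forall i, edge_rel E x (h i), ~~ edge_rel E x b & ~~ edge_rel E x c].
Proof.
move=> /allPn[x _]; rewrite negbK => /andP[/subsetP pE /subsetP aE]; exists x; split.
- by move=> i; apply: pE; apply: imset_f.
- by have := aE [set x; b]; rewrite !inE eqxx; apply.
- by have := aE [set x; c]; rewrite !inE eqxx orbT; apply.
Qed.

Lemma card_ext_roots : (#|ext_roots| <= k + 2)%N.
Proof.
apply: leq_trans (leq_card_setU _ _) _; apply: leq_add.
  by apply: leq_trans (leq_imset_card _ _) _; rewrite card_ord.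
by rewrite cards2 ltnS leq_b1.
Qed.

Lemma ext_edgeP x e : e \in ext_present x :|: ext_absent x ->
  exists2 y, y \in ext_roots & e = [set x; y].
Proof.
rewrite !inE => /orP[/imsetP[i _ ->]|/orP[]/eqP->].
- by exists (h i) => //; rewrite inE imset_f.
- by exists b => //; rewrite !inE eqxx orbT.
- by exists c => //; rewrite !inE eqxx !orbT.
Qed.

Hypotheses (bh : b \notin codom h) (ch : c \notin codom h).

(** At least [n - (k + 2)] independent candidates must all fail, and each succeeds with probability
    at least [p ^+ k * (1 - p) ^+ 2]. *)
Lemma expect_no_extension (R : realType) (p : R) : 0 <= p <= 1 ->
  gnp_expect p (fun E => (no_extension E)%:R) <=
  (1 - p ^+ k * (1 - p) ^+ 2) ^+ (n - (k + 2)).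
Proof.
move=> /andP[p0 p1].
have q0 : 0 <= 1 - p by rewrite subr_ge0.
have q1 : 1 - p <= 1 by rewrite gerBl.
have pq01 i j : 0 <= p ^+ i * (1 - p) ^+ j <= 1.
  by rewrite mulr_ge0 ?exprn_ge0 // mulr_ile1 ?exprn_ge0 ?exprn_ile1.
have sub x e : x \in enum (~: ext_roots) -> e \in ext_present x :|: ext_absent x ->
    e \in vpairs n.
  rewrite mem_enum inE => xr /ext_edgeP[y yr ->]; apply: set2_vpairs.
  by apply: contraNneq xr => ->.
have -> : gnp_expect p (fun E => (no_extension E)%:R) =
    \prod_(x <- enum (~: ext_roots))
      (1 - p ^+ #|ext_present x| * (1 - p) ^+ #|ext_absent x|).
  transitivity (p ^+ #|@set0 {set 'I_n}| * (1 - p) ^+ #|@set0 {set 'I_n}| *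
    \prod_(x <- enum (~: ext_roots))
      (1 - p ^+ #|ext_present x| * (1 - p) ^+ #|ext_absent x|)); last first.
    by rewrite cards0 !expr0 !mul1r.
  rewrite -gnp_expect_pattern_avoid ?sub0set ?enum_uniq //.
  - by apply: eq_gnp_expect => E; rewrite /pattern !sub0set mul1r prod_1Bnat.
  - by rewrite disjoints_subset sub0set.
  - by move=> x xr; apply/subsetP => e ex; apply: (sub x); rewrite // inE ex.
  - by move=> x xr; apply/subsetP => e ex; apply: (sub x); rewrite // inE ex orbT.
  - move=> x xr; rewrite disjoints_subset; apply/subsetP => _ /imsetP[i _ ->].
    rewrite !inE; apply/negP => /orP[]/eqP/set2_inj[[_ e]|[e1 e2]].
    + by move: bh; rewrite -e codom_f.
    + by move: bh; rewrite -e1 -e2 codom_f.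
    + by move: ch; rewrite -e codom_f.
    + by move: ch; rewrite -e1 -e2 codom_f.
  - by move=> x xr; rewrite setU0 disjoints_subset sub0set.
  - move=> x y; rewrite !mem_enum !inE => xr yr ne; rewrite disjoints_subset.
    apply/subsetP => e /ext_edgeP[u ur ->]; rewrite inE; apply/negP.
    move=> /ext_edgeP[w wr /set2_inj[[xy _]|[xw _]]].
      by move: ne; rewrite xy eqxx.
    by move: xr; rewrite xw; move: wr; rewrite !inE => ->.
apply: (@le_trans _ _ ((1 - p ^+ k * (1 - p) ^+ 2) ^+ #|~: ext_roots|)); last first.
  apply: ler_wiXn2l.
  - by rewrite subr_ge0; case/andP: (pq01 k 2%N).
  - by rewrite gerBl; case/andP: (pq01 k 2%N).
  - have := card_ext_roots; rewrite [#|~: _|]cardsCs setCK card_ord; lia.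
rewrite big_enum /= -prodr_const; apply: ler_prod => x _.
rewrite subr_ge0; apply/andP; split; first by case/andP: (pq01 #|ext_present x| #|ext_absent x|).
(* Repetitions in [h], or [b = c], only reduce the number of prescribed pairs and so raise the
   success probability. *)
rewrite lerB // ler_pM ?exprn_ge0 //; apply: ler_wiXn2l => //.
  by apply: leq_trans (leq_imset_card _ _) _; rewrite card_ord.
by rewrite cards2 ltnS leq_b1.
Qed.

End Extension.

Definition listing (x0 : 'I_n) (S : {ffun 'I_3 -> {set 'I_n}}) (i : idx) : 'I_n :=
  nth x0 (enum (S i.1)) i.2.

Definition draws : {set {set 'I_n}} := [set A : {set 'I_n} | #|A| == J].

(** The vertices of a triangle represent three parts; by [part_of_large] each has at least J
    vertices, and by [part_of_adj] any choice of J from each spans K_{J,J,J}. *)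
Lemma models_tripartite (x0 : 'I_n) (E : {set {set 'I_n}}) :
  E \subset vpairs n -> models (edge_rel E) phi ->
  (forall (h : {ffun 'I_k -> 'I_n}) b c, b \notin codom h -> c \notin codom h ->
     ~~ no_extension h b c E) ->
  exists S : {ffun 'I_3 -> {set 'I_n}},
    [/\ S \in ffun_on draws, injective (listing x0 S) &
        complete_edges (listing x0 S) \subset E].
Proof.
move=> EU /models_phiP[X [Xm [a [b [c [[aX bX cX] [ab bc ac]]]]] Xu]] ext.
have adj_sym : symmetric (edge_rel E) by move=> x y; apply: edge_rel_sym.
have adj_irr : irreflexive (edge_rel E) by move=> x; apply: edge_rel_irr.
have ext' : forall (h : {ffun 'I_k -> 'I_n}) b c, b \notin codom h -> c \notin codom h ->
    exists x, [/\ forall i, edge_rel E x (h i), ~~ edge_rel E x b & ~~ edge_rel E x c].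
  by move=> h b' c' bh ch; apply: no_extensionPn; apply: ext.
have large := part_of_large adj_sym adj_irr Xm Xu ext'.
pose q (r : 'I_3) := nth a [:: a; b; c] r.
have qX r : q r \in X by rewrite /q; case: r => [[|[|[|//]]]].
have q_adj r s : r != s -> edge_rel E (q r) (q s).
  rewrite /q; case: r => [[|[|[|//]]]] ?; case: s => [[|[|[|//]]]] ? //= _;
    by rewrite // edge_rel_sym.
have q_large r : exists B : {set 'I_n},
    B \subset part_of (edge_rel E) X (q r) /\ #|B| = J.
  have [B] : exists2 B : {set 'I_n}, B \subset part_of (edge_rel E) X (q r) & #|B| = J.
    apply: subset_of_card.
    have [s [s' [rs ss rs']]] : exists s s', [/\ r != s, s != s' & r != s'].
      case: r => [[|[|[|//]]]] ?.
      - by exists (lift ord0 ord0), (lift ord0 (lift ord0 ord0)).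
      - by exists ord0, (lift ord0 (lift ord0 ord0)).
      - by exists ord0, (lift ord0 ord0).
    by apply: (large _ (q s) (q s')) => //; apply: q_adj.
  by exists B.
have [S0 S0P] := choice q_large.
pose S := [ffun r => S0 r].
have szS r : size (enum (S r)) = J by rewrite -cardE ffunE; case: (S0P r).
have inS i : listing x0 S i \in S i.1.
  by rewrite -mem_enum mem_nth // szS.
have inP i : listing x0 S i \in part_of (edge_rel E) X (q i.1).
  by have [/subsetP + _] := S0P i.1; apply; have := inS i; rewrite [S _]ffunE.
have adjS i j : i.1 != j.1 -> edge_rel E (listing x0 S i) (listing x0 S j).
  by move=> ij; apply: (part_of_adj adj_sym Xm) (inP i) (inP j) => //; apply: q_adj.
exists S; split.
- by apply/ffun_onP => r; rewrite inE cardE szS.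
(* Vertices listed for different parts are adjacent, hence distinct as there are no loops; within
   one part the enumeration has no repetition. *)
- move=> i j e; have [ij|] := eqVneq i.1 j.1; last first.
    by move=> /adjS; rewrite e adj_irr.
  case: i j ij e => r i [s j] /= <-; rewrite /listing /= => /eqP.
  by rewrite nth_uniq ?szS ?enum_uniq // => /eqP/val_inj->.
- apply/subsetP => _ /imsetP[d dc ->]; apply: adjS.
  by move: dc; rewrite inE neq_ltn => ->.
Qed.

(** Union bound: either K_{J,J,J} occurs on one of the triples of J-sets, or the extension fails for
    one of the at most [n ^ (k + 2)] choices of [h], [b], [c]. *)
Lemma gnp_prob_phi_le (R : realType) (p : R) : (0 < n)%N -> 0 <= p <= 1 ->
  gnp_prob n p phi <= 'C(n, J)%:R ^+ 3 * p ^+ (3 * J ^ 2) +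
    n%:R ^+ (k + 2) * (1 - p ^+ k * (1 - p) ^+ 2) ^+ (n - (k + 2)).
Proof.
move=> n0 p01; pose x0 := Ordinal n0; have /andP[p0 p1] := p01.
pose valid (w : {ffun 'I_k -> 'I_n} * ('I_n * 'I_n)) :=
  (w.2.1 \notin codom w.1) && (w.2.2 \notin codom w.1).
pose copies := [pred S : {ffun 'I_3 -> {set 'I_n}} |
  (S \in ffun_on draws) && injectiveb (listing x0 S)].
rewrite gnp_probE.
apply: (@le_trans _ _ (gnp_expect p (fun E =>
   \sum_(S | copies S) (complete_edges (listing x0 S) \subset E)%:R +
   \sum_(w | valid w) (no_extension w.1 w.2.1 w.2.2 E)%:R))).
  apply: (ler_gnp_expect p01) => E EU.
  have s1 : 0 <= \sum_(S | copies S) (complete_edges (listing x0 S) \subset E)%:R :> R.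
    exact: sumr_ge0.
  have s2 : 0 <= \sum_(w | valid w) (no_extension w.1 w.2.1 w.2.2 E)%:R :> R.
    exact: sumr_ge0.
  have [mod|] := boolP (models _ _); last by rewrite addr_ge0.
  have [[w vw nw]|ext] := pselect (exists2 w, valid w & no_extension w.1 w.2.1 w.2.2 E).
    rewrite -[X in X <= _]add0r; apply: lerD => //.
    by rewrite (bigD1 w) //= nw lerDl sumr_ge0.
  have [|S [SJ Si SE]] := @models_tripartite x0 E EU mod.
    move=> h b c bh ch; apply/negP => nE; case: ext; exists (h, (b, c)) => //.
    by rewrite /valid /= bh ch.
  rewrite -[X in X <= _]addr0; apply: lerD => //.
  rewrite (bigD1 S) /=; last by rewrite SJ; apply/injectiveP.
  by rewrite SE lerDl sumr_ge0.
rewrite gnp_expectD !gnp_expect_sum; apply: lerD.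
- apply: (@le_trans _ _ (\sum_(S : {ffun 'I_3 -> {set 'I_n}} | S \in ffun_on draws) p ^+ (3 * J ^ 2))).
    rewrite [X in _ <= X](bigID (fun S => injectiveb (listing x0 S))) /=.
    rewrite -[X in X <= _]addr0; apply: lerD; last by apply: sumr_ge0 => S _; rewrite exprn_ge0.
    apply: ler_sum => S /andP[_ /injectiveP Si].
    rewrite -(card_complete_edges Si) -[X in _ <= X]mulr1 -[X in _ * X](expr0 (1 - p)).
    rewrite -(@cards0 {set 'I_n}) -gnp_expect_pattern.
    + apply: (ler_gnp_expect p01) => E _.
      by rewrite /pattern sub0set andbT.
    + exact: complete_edges_sub.
    + exact: sub0set.
    + by rewrite disjoint_sym disjoints_subset sub0set.
  rewrite sumr_const card_ffun_on card_ord -[X in X <= _]mulr_natl natrX.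
  by rewrite /draws card_draws card_ord.
- apply: (@le_trans _ _ (\sum_(w : {ffun 'I_k -> 'I_n} * ('I_n * 'I_n))
      (1 - p ^+ k * (1 - p) ^+ 2) ^+ (n - (k + 2)))).
    have c0 : 0 <= (1 - p ^+ k * (1 - p) ^+ 2) ^+ (n - (k + 2)).
      rewrite exprn_ge0 // subr_ge0 mulr_ile1 ?exprn_ge0 ?exprn_ile1 ?subr_ge0 //.
      by rewrite gerBl.
    rewrite [X in _ <= X](bigID valid) /=.
    rewrite -[X in X <= _]addr0; apply: lerD; last exact: sumr_ge0.
    by apply: ler_sum => w /andP[bh ch]; apply: expect_no_extension.
  rewrite sumr_const -[X in X <= _]mulr_natl !card_prod card_ffun !card_ord.
  by rewrite natrM natrX natrM -expr2 -exprD.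
Qed.

End Upper.

(** * The probability along n = m^J *)

Lemma bernoulli_ineq (R : realDomainType) (x : R) (n : nat) : 0 <= x <= 1 ->
  1 - n%:R * x <= (1 - x) ^+ n.
Proof.
move=> /andP[x0 x1]; elim: n => [|n IH]; first by rewrite mul0r subr0 expr0.
rewrite exprSr; apply: (@le_trans _ _ ((1 - n%:R * x) * (1 - x))).
  rewrite -natr1; have : 0 <= n%:R * x * x by rewrite !mulr_ge0.
  by move=> ?; lra.
by apply: ler_wpM2r => //; rewrite subr_ge0.
Qed.

(** Bernoulli gives at least 1/2 for the exponent [h]; squaring reaches the exponent [2 * h]. *)
Lemma exp_nat_ge_quarter (R : realFieldType) (h : nat) : (0 < h)%N ->
  4^-1 <= (1 - (2 * h)%:R^-1) ^+ (2 * h) :> R.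
Proof.
move=> h0; have hR : 0 < h%:R :> R by rewrite ltr0n.
have x1 : 0 <= ((2 * h)%:R^-1 : R) <= 1.
  by rewrite invr_ge0 ler0n /= invf_le1 ?ltr0n ?ler1n; lia.
have := bernoulli_ineq h x1.
have -> : h%:R * (2 * h)%:R^-1 = 2^-1 :> R.
  by rewrite natrM invfM mulrCA divff ?mulr1 // gt_eqF.
move=> le; rewrite [X in _ <= _ ^+ X]mulnC exprM.
have -> : 4^-1 = (1 - 2^-1) ^+ 2 :> R by field.
apply: lerXn2r; rewrite ?nnegrE //; first by lra.
by apply: exprn_ge0; rewrite subr_ge0; case/andP: x1.
Qed.

Lemma half_le_of_1B (R : realFieldType) (x y : R) :
  x <= 2^-1 -> 1 - x <= y -> 2^-1 <= y.
Proof. lra. Qed.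

(** The final balance of the lower bound: 1/128 - 1/256 - 1/512 = 1/512. *)
Lemma lower_margin (R : realFieldType) (s : R) :
  s <= 256^-1 -> 512^-1 <= 2^-1 * 64^-1 - (s + 512^-1).
Proof. lra. Qed.

Lemma six_pow_inv_le (R : realFieldType) : 6^-1 ^+ 6 <= 256^-1 :> R.
Proof. lra. Qed.

Lemma inv_mul_le_inv (R : realFieldType) (m a c : nat) : (0 < m)%N -> (0 < c)%N ->
  (c * a <= m)%N -> m%:R^-1 * a%:R <= c%:R^-1 :> R.
Proof.
move=> m0 c0 le.
rewrite mulrC ler_pdivrMr ?ltr0n // mulrC ler_pdivlMr ?ltr0n // mulrC.
by rewrite -natrM ler_nat.
Qed.

Lemma ffact_le_expn (n m : nat) : (n ^_ m <= n ^ m)%N.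
Proof.
elim: m => [|m IH]; first by rewrite ffactn0.
by rewrite ffactnSr expnSr leq_mul // leq_subr.
Qed.

Section Scale.
Variables (R : realType) (k l : nat).
Hypotheses (k0 : (0 < k)%N) (l0 : (0 < l)%N).
Local Notation J := k.+1.
(** The factor [6 * J] makes [n] divisible by [3 * J], for equal blocks, and even, for
    [exp_nat_ge_quarter]. *)
Local Notation m := (6 * J * l)%N.
Local Notation n := (m ^ J)%N.
Local Notation p := (m%:R^-1 : R).

Let m0 : (0 < m)%N. Proof. by rewrite !muln_gt0 l0. Qed.
Let mR : 0 < m%:R :> R. Proof. by rewrite ltr0n. Qed.
Let n0 : (0 < n)%N. Proof. by rewrite expn_gt0 m0. Qed.
Let p0 : 0 < p. Proof. by rewrite invr_gt0. Qed.
Let p1 : p <= 1. Proof. by rewrite invf_le1 // ler1n. Qed.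
Let npJ : n%:R * p ^+ J = 1.
Proof. by rewrite natrX -exprMn divff ?expr1n // gt_eqF. Qed.

(** With blocks of size [n / (3 * J)], the expected number of copies is the constant [s]. Isolation
    costs a factor of at least 1/128, and the pairs subtract at most [s * (s + 512^-1)]. *)
Lemma gnp_prob_phi_lower :
  (18 * J ^ 2 <= m)%N -> (512 * 2 ^ (3 * J) <= m)%N ->
  (3 * J)%:R^-1 ^+ (3 * J) / 512 <= gnp_prob n p phi.
Proof.
move=> m1 m2; set s : R := _ ^+ _.
pose b := (2 * l * m ^ k)%N.
have nE : (3 * J * b)%N = n by rewrite /b expnS; lia.
have cardE : #|{: ('I_3 * 'I_J) * 'I_b}| = n by rewrite card_prod card_idx card_ord.
pose g (x : ('I_3 * 'I_J) * 'I_b) : 'I_n := cast_ord cardE (enum_rank x).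
have g_inj : injective g by move=> x y /cast_ord_inj/enum_rank_inj.
have := gnp_prob_phi_ge g_inj p0 p1 npJ (ltn0Sn k).
have JR : 0 < (3 * J)%:R :> R by rewrite ltr0n.
have bpJ : b%:R * p ^+ J = (3 * J)%:R^-1.
  apply: (mulfI (lt0r_neq0 JR)); rewrite divff ?lt0r_neq0 //.
  by rewrite mulrA -natrM nE npJ.
have sE : b%:R ^+ (3 * J) * p ^+ (3 * J ^ 2) = s.
  have -> : (3 * J ^ 2)%N = (J * (3 * J))%N by lia.
  by rewrite [p ^+ _]exprM -exprMn bpJ.
have s0 : 0 < s by rewrite exprn_gt0 // invr_gt0.
(* Since [k > 0], [3 * J] is at least 6. *)
have s256 : s <= 256^-1.
  apply: (@le_trans _ _ (6^-1 ^+ 6)); last exact: six_pow_inv_le.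
  apply: (@le_trans _ _ ((3 * J)%:R^-1 ^+ 6)).
    by apply: ler_wiXn2l; rewrite ?invr_ge0 ?ler0n ?invf_le1 ?ler1n //; lia.
  by apply: lerXn2r; rewrite ?nnegrE ?invr_ge0 ?lef_pV2 ?posrE // (ler_nat _ 6); lia.
have second : b%:R ^+ (3 * J) * (p ^+ (6 * J ^ 2) *
     (b%:R ^+ (3 * J) + p * (b%:R + n%:R) ^+ (3 * J))) <= s * (s + 512^-1).
  have -> : (6 * J ^ 2)%N = (3 * J ^ 2 + 3 * J ^ 2)%N by lia.
  rewrite exprD -mulrA mulrA sE; apply: ler_wpM2l; first exact: ltW.
  rewrite mulrDr [X in X + _]mulrC sE lerD2l mulrCA.
  have -> : p ^+ (3 * J ^ 2) * (b%:R + n%:R) ^+ (3 * J) =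
            ((3 * J)%:R^-1 + 1) ^+ (3 * J).
    have -> : (3 * J ^ 2)%N = (J * (3 * J))%N by lia.
    by rewrite [p ^+ _]exprM -exprMn mulrC mulrDl bpJ npJ.
  apply: (@le_trans _ _ (p * 2 ^+ (3 * J))).
    apply: ler_wpM2l; first exact: ltW.
    apply: lerXn2r; rewrite ?nnegrE ?addr_ge0 ?invr_ge0 //.
    have -> : 2 = 1 + 1 :> R by [].
    by rewrite lerD2r invf_le1 // ler1n.
  by rewrite -natrX; apply: inv_mul_le_inv m0 _ m2.
have first_ : 2^-1 <= (1 - p) ^+ (9 * J ^ 2).
  apply: half_le_of_1B (bernoulli_ineq _ _); last by rewrite p1 ltW.
  rewrite mulrC; apply: inv_mul_le_inv m0 _ _ => //.
  by rewrite mulnA.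
have third : 64^-1 <= (1 - p ^+ J) ^+ (3 * n).
  have -> : p ^+ J = n%:R^-1 by rewrite natrX exprVn.
  pose h := (3 * J * l * m ^ k)%N.
  have -> : n = (2 * h)%N by rewrite /h expnS !mulnA.
  have h0 : (0 < h)%N by rewrite /h !muln_gt0 l0 expn_gt0 m0.
  rewrite [X in _ <= _ ^+ X]mulnC exprM.
  have -> : 64^-1 = 4^-1 ^+ 3 :> R by field.
  apply: lerXn2r; last exact: exp_nat_ge_quarter; rewrite nnegrE ?invr_ge0 //.
  by apply: exprn_ge0; rewrite subr_ge0 invf_le1 ?ltr0n ?ler1n muln_gt0 h0.
rewrite -[p ^+ (3 * J ^ 2) * _ * _]mulrA mulrA sE => low.
apply: le_trans low; apply: (@le_trans _ _ (s * (2^-1 * 64^-1) - s * (s + 512^-1))).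
  rewrite -mulrBr; by apply: ler_wpM2l; [exact: ltW|exact: lower_margin].
by apply: lerB second; apply: ler_wpM2l; [exact: ltW|apply: ler_pM].
Qed.

Lemma gnp_prob_phi_upper :
  (4 * (8 ^ (J * (k + 2)).+1 * (J * (k + 2)).+1`!) <= m)%N ->
  gnp_prob n p phi <= 3 / 8.
Proof.
set K := (J * (k + 2))%N => mK.
have p01 : 0 <= p <= 1 by rewrite p1 ltW.
apply: le_trans (gnp_prob_phi_le k n0 p01) _.
have -> : 3 / 8 = 2^-1 ^+ 3 + 4^-1 :> R by field.
apply: lerD.
  have -> : (3 * J ^ 2)%N = (J * J * 3)%N by lia.
  rewrite [p ^+ _]exprM -exprMn; apply: lerXn2r; rewrite ?nnegrE ?invr_ge0 ?mulr_ge0 ?exprn_ge0 //.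
  have JR : 0 < J`!%:R :> R by rewrite ltr0n fact_gt0.
  apply: (@le_trans _ _ (J`!%:R^-1)); last first.
    rewrite lef_pV2 ?posrE // (ler_nat _ 2).
    by apply: leq_trans (fact_geq J); lia.
  rewrite -[X in _ <= X]mul1r ler_pdivlMr // mulrAC -natrM bin_ffact.
  apply: (@le_trans _ _ ((n ^ J)%:R * p ^+ (J * J))).
    apply: ler_wpM2r; first by rewrite exprn_ge0.
    by rewrite ler_nat ffact_le_expn.
  by rewrite natrX exprM -exprMn npJ expr1n.
set u := p ^+ k * (1 - p) ^+ 2; set N := (n - (k + 2))%N.
have p2 : p <= 2^-1 by rewrite lef_pV2 ?posrE // (ler_nat _ 2); lia.
have u_ge : p ^+ k * 4^-1 <= u.
  apply: ler_wpM2l; first by rewrite exprn_ge0.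
  have -> : 4^-1 = 2^-1 ^+ 2 :> R by field.
  by apply: lerXn2r; rewrite ?nnegrE ?invr_ge0 ?subr_ge0 //; exact: half_le_of_1B p2 _.
have u0 : 0 <= u by rewrite mulr_ge0 ?exprn_ge0 ?subr_ge0.
have u1 : u <= 1 by rewrite mulr_ile1 ?exprn_ge0 ?exprn_ile1 ?subr_ge0 ?gerBl // ltW.
have N_ge : n%:R / 2 <= N%:R :> R.
  rewrite ler_pdivrMr // -natrM ler_nat /N.
  suff : (2 * (k + 2) <= n)%N by lia.
  apply: (@leq_trans m); first by apply: (@leq_trans (6 * J)%N); [lia|exact: leq_pmulr].
  by rewrite -[X in (X <= _)%N]expn1 leq_exp2l //; lia.
(* [p ^+ k * n = m]; the 8 combines 1/4 from [(1 - p) ^+ 2] with 1/2 from [N_ge]. *)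
have uN : m%:R / 8 <= u * N%:R.
  apply: (@le_trans _ _ (p ^+ k * 4^-1 * (n%:R / 2))); last first.
    by apply: ler_pM => //; rewrite mulr_ge0 ?exprn_ge0 ?invr_ge0.
  have -> : p ^+ k * 4^-1 * (n%:R / 2) = (p ^+ k * n%:R) / 8 by field.
  rewrite natrX exprSr mulrA -exprMn mulVf ?expr1n ?mul1r //.
  by rewrite gt_eqF.
apply: (@le_trans _ _ (n%:R ^+ (k + 2) * (expR (m%:R / 8))^-1)).
  apply: ler_wpM2l; first by rewrite exprn_ge0.
  apply: (@le_trans _ _ (expR (- u) ^+ N)).
    apply: lerXn2r; rewrite ?nnegrE ?expR_ge0 ?subr_ge0 //.
    exact: expR_ge1Dx.
  by rewrite -expRM_natl -expRN ler_expR mulrN lerN2 [N%:R * _]mulrC.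
rewrite natrX -exprM -/K ler_pdivrMr ?expR_gt0 //.
(* The term of degree [K.+1] in the exponential series beats [m ^ K] by a factor [m], which absorbs
   the constants through [mK]. *)
have m8 : 0 <= m%:R / 8 :> R by rewrite mulr_ge0.
have := expR_ge1Dxn K m8.
set e := expR _ => eK.
suff : 4 * m%:R ^+ K <= (m%:R / 8) ^+ K.+1 / (K.+1)`!%:R :> R by move=> ?; lra.
rewrite ler_pdivlMr ?ltr0n ?fact_gt0 // exprMn exprVn ler_pdivlMr ?exprn_gt0 //.
rewrite -!natrX -!natrM ler_nat [X in (_ <= X)%N]expnS.
have reorder (a x y z : nat) : (a * x * y * z = a * (z * y) * x)%N by
  rewrite -!mulnA; congr (_ * _)%N; rewrite mulnCA [(x * z)%N]mulnC mulnCA.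
by rewrite reorder leq_mul2r mK orbT.
Qed.

End Scale.

(** * Infinitely many exponents in the spectrum *)

Lemma powR_root_inv (R : realType) (m J : nat) : (0 < J)%N ->
  (m ^ J)%:R `^ (- J%:R^-1) = m%:R^-1 :> R.
Proof.
move=> J0; rewrite powRN natrX -powR_mulrn ?ler0n // -powRrM divff ?powRr1 //.
by rewrite pnatr_eq0; lia.
Qed.

(** For arbitrarily large [n] of the form [m ^ J] the probability lies between a fixed [s > 0] and
    3/8, which excludes both limits. *)
Lemma spectrum_inv (R : realType) (k : nat) : (0 < k)%N ->
  spectrum R phi (k.+1%:R^-1).
Proof.
move=> k0; split; first by rewrite invr_gt0 ltr0n.
pose s : R := (3 * k.+1)%:R^-1 ^+ (3 * k.+1) / 512.
have s0 : 0 < s.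
  apply: divr_gt0; last by rewrite ltr0n.
  by apply: exprn_gt0; rewrite invr_gt0 ltr0n.
pose K := (k.+1 * (k + 2))%N.
(* The sum of the three thresholds on [m] required by the lower and upper bounds. *)
pose M := (18 * k.+1 ^ 2 + 512 * 2 ^ (3 * k.+1) + 4 * (8 ^ K.+1 * K.+1`!))%N.
have bounds N : exists2 n, (N <= n)%N &
    s <= gnp_prob n ((n%:R : R) `^ (- k.+1%:R^-1)) phi <= 3 / 8.
  pose l := (N + M).+1; pose m := (6 * k.+1 * l)%N.
  have lm : (l <= m)%N by rewrite /m leq_pmull.
  have Mm : (M <= m)%N by apply: leq_trans lm; rewrite /l; lia.
  exists (m ^ k.+1)%N.
    apply: (@leq_trans m); first by apply: leq_trans lm; rewrite /l; lia.
    by rewrite -[X in (X <= _)%N]expn1 leq_exp2l // /m /l; lia.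
  have l0 : (0 < l)%N by [].
  rewrite powR_root_inv; last by [].
  apply/andP; split.
    apply: gnp_prob_phi_lower => //; apply: leq_trans Mm; rewrite /M -addnA.
      exact: leq_addr.
    by rewrite addnCA; exact: leq_addr.
  exact: gnp_prob_phi_upper k0 l0 (leq_trans (leq_addl _ _) Mm).
case=> /cvgrPdist_lt cv.
- have [N _ NP] := cv _ s0; have [n Nn /andP[sP _]] := bounds N.
  have := NP n Nn; rewrite /= sub0r normrN ger0_norm ?(le_trans (ltW s0)) //.
  by rewrite ltNge sP.
- have [//|N _ NP] := cv 2^-1; have [n Nn /andP[_ Ps]] := bounds N.
  have := NP n Nn; rewrite /=; have := ler_norm (1 - gnp_prob n (n%:R `^ (- k.+1%:R^-1)) phi : R).
  by move=> ? ?; lra.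
Qed.

Theorem theorem3 (R : realType) :
  exists phi : sentence, qdepth phi = 4%N /\ infinite_set (spectrum R phi).
Proof.
exists phi; split; first exact: qdepth_phi.
move=> fin; apply: infinite_nat.
(* The injection sending [k] to the inverse of [k + 2] lands in the spectrum, so a finite spectrum
   would make the naturals finite; the shift by 2 ensures that J is at least 2. *)
have -> : [set: nat]%classic =
    ((fun k : nat => k.+2%:R^-1 : R) @^-1` spectrum R phi)%classic.
  by apply/seteqP; split => // k _; apply: spectrum_inv.
apply: finite_preimage fin => i j _ _ /invr_inj/eqP.
by rewrite eqr_nat => /eqP[].
Qed.
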